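(* If $P,Q\le S_\infty$ are both non-compact Polish permutation groups, then the (generalized) Bernoulli shift of $P\,\mathrm{Wr}\,Q$ has a generically unbalanced closed subshift; that is, there is a closed $(P\,\mathrm{Wr}\,Q)$-invariant subset of $\mathbb{R}^{\mathbb{N}\times\mathbb{N}}$ which is a generically unbalanced Polish $(P\,\mathrm{Wr}\,Q)$-space.
   Context: $S_\infty=S(\mathbb N)$ is the group of all permutations of $\mathbb N$ with the pointwise convergence topology; a Polish permutation group on a countable set $N$ is a closed subgroup of $S(N)$. For Polish permutation groups $P\le S(N)$ and $Q\le S(M)$, the wreath product $P\,\mathrm{Wr}\,Q$ is the Polish group with underlying space $P\times Q^N$ (product topology) and multiplication $(p_2,\boldsymbol q_2)(p_1,\boldsymbol q_1)=(p_2p_1,\boldsymbol h)$, where $\boldsymbol h(n)=\boldsymbol q_2(p_1(n))\,\boldsymbol q_1(n)$. It is viewed as a Polish permutation group on $N\times M$ via the faithful action $(p,\boldsymbol q)\cdot(n,m)=(p(n),\boldsymbol q(n)(m))$. The generalized Bernoulli shift of a Polish permutation group $R\le S(K)$ is the Polish $R$-space $\mathbb{R}^K$ with $(r\cdot x)(k)=x(r^{-1}(k))$. For a Polish $G$-space $X$ (a Polish space with a continuous left action of the Polish group $G$) and $x,y\in X$ write $x\leftrightsquigarrow y$ if for every open neighborhood $V$ of the identity of $G$ and every open $U\subseteq X$ having nonempty intersection with the orbit of $x$ or with the orbit of $y$, there exist $g^x,g^y\in G$ with $g^xx\in U$ and $g^yy\in U$ such that $g^yy\in\overline{V(g^xx)}$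 and $g^xx\in\overline{V(g^yy)}$. This is symmetric and invariant under the action in each variable, so one writes $[x]\leftrightsquigarrow[y]$ for orbits when $x\leftrightsquigarrow y$. For a $G$-invariant $C\subseteq X$, let $C/G=\{[x]: x\in C\}$. A path in $C/G$ from $[x]$ to $[y]$ is a sequence $x_0,\dots,x_{n-1}\in C$ with $x_0=x$, $x_{n-1}=y$ and $x_{i-1}\leftrightsquigarrow x_i$ for all $0<i<n$. $(X/G,\leftrightsquigarrow)$ is generically semi-connected if for every $G$-invariant comeager $C\subseteq X$ there is a comeager $D\subseteq C$ such that for all $x,y\in D$ there is a path between $[x]$ and $[y]$ in $(C/G,\leftrightsquigarrow)$. $X$ is generically unbalanced if all its orbits are meager (in $X$) and $(X/G,\leftrightsquigarrow)$ is generically semi-connected. *)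

(* Defs.v *)
From HB Require Import structures.
From mathcomp Require Import all_boot all_order all_algebra.
From mathcomp Require Import all_classical all_reals all_analysis.
Import Order.TTheory GRing.Theory Num.Theory.
Import numFieldNormedType.Exports.

Set Implicit Arguments.
Unset Strict Implicit.
Unset Printing Implicit Defensive.

Local Open Scope classical_set_scope.

Section category.
Context {X : topologicalType}.
Implicit Types A : set X.

Definition nowhere_dense A := (closure A)° = set0.

Definition meager A := exists2 F : nat -> set X,
  (forall n, nowhere_dense (F n)) & A `<=` \bigcup_n F n.

Definition comeager A := meager (~` A).

End category.

(* The real numbers are an arbitrary R : realType; d is a complete metric
   inducing the topology of X. *)
Definition complete_metric_for (R : realType) (X : topologicalType)
    (d : X -> X -> R) : Prop :=
  [/\ forall x y, d x y = 0%R <-> x = y,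
      forall x y, d x y = d y x,
      forall x y z, (d x z <= d x y + d y z)%R,
      forall x A, nbhs x A <->
        exists2 e : R, (0 < e)%R & [set y | (d x y < e)%R] `<=` A &
      forall u : nat -> X,
        (forall e : R, (0 < e)%R ->
          exists k : nat, forall m n : nat, (k <= m)%N -> (k <= n)%N ->
            (d (u m) (u n) < e)%R) ->
        exists l : X, u @ \oo --> l].

Definition polish (R : realType) (X : topologicalType) : Prop :=
  (exists d : X -> X -> R, complete_metric_for d) /\
  (exists2 A : set X, countable A & dense A).

(* No compatibility between the two structures is built in; it is required in
   polish_group. *)
#[short(type="groupTopologicalType")]
HB.structure Definition GroupTopological := {G of Group G & Topological G}.

Definition polish_group (R : realType) (G : groupTopologicalType) : Prop :=
  [/\ polish R G,
      continuous (fun gh : G * G => (gh.1 * gh.2)%g) &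
      continuous (fun g : G => (g^-1)%g)].

Section actions.
Context {G : groupTopologicalType} {X : topologicalType}.
Variable act : G -> X -> X.

Definition polish_Gspace (R : realType) : Prop :=
  [/\ polish_group R G, polish R X,
      forall x, act 1%g x = x,
      forall g h x, act (g * h)%g x = act g (act h x) &
      continuous (fun gx : G * X => act gx.1 gx.2)].

Definition invariant_set (C : set X) := forall g x, C x -> C (act g x).

Definition translates (V : set G) (x : X) : set X := [set act g x | g in V].

Definition orbit_set (x : X) : set X := translates setT x.

(* x <~~> y *)
Definition linked (x y : X) : Prop :=
  forall (V : set G) (U : set X), open_nbhs 1%g V -> open U ->
    U `&` orbit_set x !=set0 \/ U `&` orbit_set y !=set0 ->
    exists gx gy : G,
      [/\ U (act gx x), U (act gy y),
          closure (translates V (act gx x)) (act gy y) &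
          closure (translates V (act gy y)) (act gx x)].

(* The path consists of the n.+1 points s 0, ..., s n. *)
Definition path_in (C : set X) (x y : X) : Prop :=
  exists (n : nat) (s : nat -> X),
    [/\ s 0%N = x, s n = y,
        forall i, (i <= n)%N -> C (s i) &
        forall i, (i < n)%N -> linked (s i) (s i.+1)].

Definition generically_semi_connected : Prop :=
  forall C : set X, invariant_set C -> comeager C ->
    exists D : set X, [/\ comeager D, D `<=` C &
      forall x y, D x -> D y -> path_in C x y].

Definition generically_unbalanced : Prop :=
  (forall x, meager (orbit_set x)) /\ generically_semi_connected.

Section restriction.
Variables (Y : set X) (Yinv : invariant_set Y).

Definition restr_act (g : G) (y : Y) : Y :=
  SigSub (mem_set (Yinv g (set_mem (valP y)))).

End restriction.
End actions.

Record perm (N : Type) := Perm {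
  perm_fun :> N -> N;
  perm_inv : N -> N;
  perm_funK : cancel perm_fun perm_inv;
  perm_invK : cancel perm_inv perm_fun }.

Lemma perm_ext (N : Type) (p q : perm N) : p =1 q -> p = q.
Proof.
case: p q => [p p' pK p'K] [q q' qK q'K] /= /funext pq; subst q.
have e : p' = q' by apply/funext => n; rewrite -{1}(q'K n) pK.
by subst q'; congr Perm; exact: Prop_irrelevance.
Qed.

Section perm_group.
Variable N : Type.

HB.instance Definition _ := gen_eqMixin (perm N).
HB.instance Definition _ := gen_choiceMixin (perm N).

Definition perm_one : perm N :=
  @Perm N id id (fun=> erefl) (fun=> erefl).
Definition perm_opp (p : perm N) : perm N :=
  Perm (@perm_invK N p) (@perm_funK N p).
Definition perm_mul (p q : perm N) : perm N :=
  Perm (can_comp (@perm_funK N p) (@perm_funK N q))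
       (can_comp (@perm_invK N q) (@perm_invK N p)).

Let mulA : associative perm_mul.
Proof. by move=> p q r; apply: perm_ext. Qed.
Let mul1 : left_id perm_one perm_mul.
Proof. by move=> p; apply: perm_ext. Qed.
Let mulr1 : right_id perm_one perm_mul.
Proof. by move=> p; apply: perm_ext. Qed.
Let mulV : left_inverse perm_one perm_opp perm_mul.
Proof. by move=> p; apply: perm_ext => n /=; rewrite perm_funK. Qed.
Let mulrV : right_inverse perm_one perm_opp perm_mul.
Proof. by move=> p; apply: perm_ext => n /=; rewrite perm_invK. Qed.

HB.instance Definition _ := isGroup.Build (perm N) mulA mul1 mulr1 mulV mulrV.

End perm_group.

(* The topology of pointwise convergence on S(N), for N discrete. *)
HB.instance Definition _ (N : choiceType) := Topological.copy (perm N)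
  (initial_topology
    (fun p : perm N => (p : N -> N) : {ptws N -> discrete_topology N})).

Record polish_perm_group (N : countType) := PolishPermGroup {
  ppg_set :> set (perm N);
  ppg1 : ppg_set 1%g;
  ppgM : forall p q, ppg_set p -> ppg_set q -> ppg_set (p * q)%g;
  ppgV : forall p, ppg_set p -> ppg_set (p^-1)%g;
  ppg_closed : closed ppg_set }.

Section ppg_group.
Variables (N : countType) (P : polish_perm_group N).

Lemma ppg_in (p : P) : ppg_set P (val p).
Proof. exact: set_mem (valP p). Qed.

Definition ppg_one : P := SigSub (mem_set (ppg1 P)).
Definition ppg_inv (p : P) : P := SigSub (mem_set (ppgV (ppg_in p))).
Definition ppg_mul (p q : P) : P :=
  SigSub (mem_set (ppgM (ppg_in p) (ppg_in q))).

Let mulA : associative ppg_mul.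
Proof. by move=> p q r; apply: val_inj; rewrite /= mulgA. Qed.
Let mul1 : left_id ppg_one ppg_mul.
Proof. by move=> p; apply: val_inj; rewrite /= mul1g. Qed.
Let mulr1 : right_id ppg_one ppg_mul.
Proof. by move=> p; apply: val_inj; rewrite /= mulg1. Qed.
Let mulV : left_inverse ppg_one ppg_inv ppg_mul.
Proof. by move=> p; apply: val_inj; rewrite /= mulVg. Qed.
Let mulrV : right_inverse ppg_one ppg_inv ppg_mul.
Proof. by move=> p; apply: val_inj; rewrite /= mulgV. Qed.

HB.instance Definition _ :=
  isGroup.Build (set_type (ppg_set P)) mulA mul1 mulr1 mulV mulrV.

End ppg_group.

Definition wreath (N M : countType)
    (P : polish_perm_group N) (Q : polish_perm_group M) : Type :=
  (P * {ptws N -> Q})%type.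

HB.instance Definition _ (N M : countType)
    (P : polish_perm_group N) (Q : polish_perm_group M) :=
  Topological.copy (wreath P Q) (P * {ptws N -> Q})%type.

Section wreath_group.
Variables (N M : countType).
Variables (P : polish_perm_group N) (Q : polish_perm_group M).

Definition wreath_one : wreath P Q := (1%g, fun=> 1%g).
Definition wreath_mul (g2 g1 : wreath P Q) : wreath P Q :=
  ((g2.1 * g1.1)%g, fun n => (g2.2 (val g1.1 n) * g1.2 n)%g).
Definition wreath_inv (g : wreath P Q) : wreath P Q :=
  ((g.1^-1)%g, fun n => ((g.2 (val (g.1^-1)%g n))^-1)%g).

Let mulA : associative wreath_mul.
Proof.
move=> g h k; congr pair; first exact: mulgA.
by apply/funext => n /=; rewrite mulgA.
Qed.
Let mul1 : left_id wreath_one wreath_mul.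
Proof.
by move=> [p q]; congr pair; [exact: mul1g|apply/funext => n; exact: mul1g].
Qed.
Let mulr1 : right_id wreath_one wreath_mul.
Proof.
by move=> [p q]; congr pair; [exact: mulg1|apply/funext => n; exact: mulg1].
Qed.
Let mulV : left_inverse wreath_one wreath_inv wreath_mul.
Proof.
move=> [p q]; congr pair; first exact: mulVg.
by apply/funext => n /=; rewrite perm_funK mulVg.
Qed.
Let mulrV : right_inverse wreath_one wreath_inv wreath_mul.
Proof.
by move=> [p q]; congr pair; [exact: mulgV|apply/funext => n; exact: mulgV].
Qed.

HB.instance Definition _ :=
  isGroup.Build (wreath P Q) mulA mul1 mulr1 mulV mulrV.

Definition wreath_fun (g : wreath P Q) (k : N * M) : N * M :=
  (val g.1 k.1, val (g.2 k.1) k.2).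

Lemma wreath_fun1 : wreath_fun 1%g =1 id.
Proof. by case. Qed.

Lemma wreath_funM (g h : wreath P Q) :
  wreath_fun (g * h)%g =1 wreath_fun g \o wreath_fun h.
Proof. by []. Qed.

Lemma wreath_funK (g : wreath P Q) :
  cancel (wreath_fun g) (wreath_fun (g^-1)%g).
Proof.
move=> k; rewrite -[LHS](wreath_funM (g^-1)%g g) mulVg; exact: wreath_fun1.
Qed.

Lemma wreath_invK (g : wreath P Q) :
  cancel (wreath_fun (g^-1)%g) (wreath_fun g).
Proof.
move=> k; rewrite -[LHS](wreath_funM g (g^-1)%g) mulgV; exact: wreath_fun1.
Qed.

Definition wreath_perm (g : wreath P Q) : perm (N * M)%type :=
  Perm (wreath_funK g) (wreath_invK g).

End wreath_group.

Definition bernoulli (R : realType) (K : countType)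
    (r : perm K) (x : {ptws K -> R}) : {ptws K -> R} :=
  fun k => x ((r^-1)%g k).

Definition wreath_bernoulli (R : realType) (N M : countType)
    (P : polish_perm_group N) (Q : polish_perm_group M)
    (g : wreath P Q) (x : {ptws N * M -> R}) : {ptws N * M -> R} :=
  bernoulli (wreath_perm g) x.

(* Main.v *)
Require Import Defs.
From HB Require Import structures.
From mathcomp Require Import all_boot all_order all_algebra.
From mathcomp Require Import all_classical all_reals all_analysis.
From mathcomp Require Import lra zify.
Import Order.TTheory GRing.Theory Num.Theory.
Import numFieldNormedType.Exports.

(** A closed permutation group all of whose orbits are finite is compact, so [P]
    and [Q] have points with infinite orbits ([noncompact_infinite_orbit]).  Let [A]
    and [B] be the sets of these points.  The subshift consists of the real arrays
    on [nat * nat] that vanish off [A * B]; its elements are thought of as families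
    of rows, where [P] permutes the rows and the copy of [Q] at place [a] shifts the
    row there.

    Orbits are meager ([orbit_meager]), because a group element only rearranges the
    entries, so that a given entry takes countably many values along an orbit.

    For semi-connectedness, the key is that a generic row has a dense orbit under
    [Q]; this follows from the lemma of Neumann ([neumann_separation]): a group
    whose orbits are infinite moves any finite set off any other one.  For
    every neighborhood of the identity of the wreath product there are finitely many
    rows such that it contains all elements which act trivially on the base and in
    these rows, whatever they do in the other rows.  Hence two arrays with dense
    rows that agree in these finitely many rows lie in the closure of each other's
    translates ([closure_translates]).  Consequently two arrays with dense rows are linked as soon as they agree on a
    set [S] of rows into which [P] can move every finite part of [A]: move enough
    common rows to the finitely many places that matter ([linked_of_rows]).

    Again by the lemma of Neumann, there is a set [S] such that both [S] and its
    complement have this property ([absorbing_split]).  Given arrays [x] and [y],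
    replace their rows outside [S] by those of a third array [u].  The results
    [x'] and [y'] are linked to [x] and to [y], respectively, through the rows in
    [S], and to each other through the rows outside [S].  By a Kuratowski-Ulam
    argument ([generic_mix]), for generic [x] and [y] there is a [u] for which [x']
    and [y'] lie in a prescribed comeager set and have dense rows; so
    [x], [x'], [y'], [y] is the required path ([subshift_semi_connected]). *)

Set Implicit Arguments.
Unset Strict Implicit.
Unset Printing Implicit Defensive.

Local Open Scope classical_set_scope.
Local Open Scope ring_scope.

(** * Convergence in initial and pointwise topologies *)

Lemma filter_all_seq (T : Type) (F : set_system T) (FF : Filter F)
    (K : eqType) (L : seq K) (P : K -> set T) :
  (forall k, k \in L -> F (P k)) -> F [set x | forall k, k \in L -> P k x].
Proof.
elim: L => [|k L IH] H; first by apply: filterS filterT => x _ k.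
have /IH FL : forall j, j \in L -> F (P j).
  by move=> j jL; apply: H; rewrite inE jL orbT.
have Fk : F (P k) by apply: H; rewrite mem_head.
apply: filterS (filterI Fk FL) => x [Pk PL] j.
by rewrite inE => /orP[/eqP->//|/PL].
Qed.

Lemma initial_cvg (S : choiceType) (T : topologicalType) (f : S -> T)
    (F : set_system S) (FF : Filter F) (s : S) :
  F --> (s : initial_topology f) <-> f @ F --> f s.
Proof.
split=> [Fs|Ffs].
  exact: cvg_trans (cvg_app f Fs) (@initial_continuous _ _ f s).
move=> A /= [_ [[B Bop <-] Bfs sBfA]].
rewrite nbhs_filterE; apply: filterS sBfA _.
by apply: Ffs; apply: open_nbhs_nbhs.
Qed.

Lemma ptws_cvg (K : Type) (T : topologicalType)
    (F : set_system {ptws K -> T}) (FF : Filter F) (f : {ptws K -> T}) :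
  F --> f <-> forall k, (fun g : {ptws K -> T} => g k) @ F --> f k.
Proof.
split=> [/cvg_sup H k|H].
  by have /initial_cvg := H k.
by apply/cvg_sup => k; apply/initial_cvg; exact: H.
Qed.

(** * Spaces given by countably many real coordinates *)

(** The hypotheses present [X] as a closed subspace of a countable power of the
    line, without mentioning the embedding: this covers the subshift, with the
    entries as coordinates, and the wreath product, with coded values. *)
Section coordinates.
Variables (R : realType) (X : topologicalType) (K : countType).
Variables (k0 : K) (c : K -> X -> R).
Hypothesis cvg_coord : forall (F : set_system X) (x : X), Filter F ->
  F --> x <-> forall k, c k @ F --> c k x.
Hypothesis coord_inj : forall x y, (forall k, c k x = c k y) -> x = y.
Hypothesis coord_complete : forall u : nat -> X,
  (forall k, cvgn (c k \o u)) -> exists l : X, u @ \oo --> l.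

Lemma coord_continuous k : continuous (c k).
Proof. by move=> x; have /cvg_coord/(_ k) : nbhs x --> x by exact: cvg_id. Qed.

Lemma coord_near x k (e : R) : 0 < e -> \forall y \near x, `|c k x - c k y| < e.
Proof. by move=> e0; have /cvgrPdist_lt/(_ e e0) := @coord_continuous k x. Qed.

Let term x y k : R := Num.min `|c k x - c k y| (pickle k).+1%:R^-1.

(** Truncating the [k]-th term at a bound that tends to 0 makes each scale [e]
    depend on finitely many coordinates only. *)
Definition coord_dist x y : R := sup (range (term x y)).

Let term_le x y k : term x y k <= coord_dist x y.
Proof.
have ub : has_ubound (range (term x y)).
  exists 1 => _ [j _ <-]; rewrite ge_min; apply/orP; right.
  by rewrite invf_le1 ?ltr0n// ler1n.
by apply: (ub_le_sup ub); exists k.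
Qed.

Let dist_le x y e : (forall k, term x y k <= e) -> coord_dist x y <= e.
Proof.
move=> H; apply: ge_sup; first by exists (term x y k0), k0.
by move=> _ [k _ <-].
Qed.

Let term_ge0 x y k : 0 <= term x y k.
Proof. by rewrite le_min normr_ge0 invr_ge0 ler0n. Qed.

Let dist_lt x y k e : coord_dist x y < Num.min e (pickle k).+1%:R^-1 ->
  `|c k x - c k y| < e.
Proof.
rewrite lt_min => /andP[d1 d2].
have := le_lt_trans (term_le x y k) d2; rewrite gt_min ltxx orbF => lt1.
have := le_lt_trans (term_le x y k) d1; rewrite gt_min => /orP[//|].
exact: lt_trans.
Qed.

(** Below the truncation bound of coordinate [k] the distance controls that
    coordinate, so balls generate the coordinate filter and Cauchy sequences are
    Cauchy in each coordinate; conversely, beyond finitely many [k] the truncation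
    alone makes the terms small. *)
Lemma coord_dist_metric : complete_metric_for coord_dist.
Proof.
have dsym x y : coord_dist x y = coord_dist y x.
  rewrite /coord_dist; suff -> : term x y = term y x by [].
  by apply/funext => k; rewrite /term distrC.
split=> //.
- move=> x y; split=> [d0|<-].
    apply: coord_inj => k; have := term_le x y k; rewrite d0 ge_min.
    have n0 : 0 < (pickle k).+1%:R^-1 :> R by rewrite invr_gt0 ltr0n.
    rewrite [X in _ || X]leNgt n0 orbF normr_le0 subr_eq0.
    by move/eqP.
  apply/le_anti/andP; split; last exact: le_trans (term_ge0 x x k0) _.
  by apply: dist_le => k; rewrite ge_min subrr normr0 lexx.
- move=> x y z; apply: dist_le => k.
  apply: le_trans (lerD (term_le x y k) (term_le y z k)).
  have n0 : 0 <= (pickle k).+1%:R^-1 :> R by rewrite invr_ge0.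
  rewrite /term; case: (leP `|c k x - c k y|) => h1; last first.
    by rewrite ge_min lerDl le_min normr_ge0 n0 orbT.
  case: (leP `|c k y - c k z|) => h2; last by rewrite ge_min lerDr normr_ge0 orbT.
  by rewrite ge_min ler_distD.
- move=> x A; split.
    pose B (e : R) := [set y | coord_dist x y < e].
    have FF : Filter (filter_from [set e : R | 0 < e] B).
      apply: filter_from_filter; first by exists 1 => /=.
      move=> e f e0 f0; exists (Num.min e f); first by rewrite /= lt_min e0.
      by move=> y; rewrite /B /= lt_min => /andP.
    suff: filter_from [set e : R | 0 < e] B --> x by apply.
    apply/cvg_coord => k; apply/cvgrPdist_lt => e e0.
    exists (Num.min e (pickle k).+1%:R^-1).
      by rewrite /= lt_min e0 invr_gt0 ltr0n.
    by move=> y; exact: dist_lt.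
  move=> [e e0 sub]; apply: filterS sub _.
  have e20 : 0 < e / 2 by rewrite divr_gt0.
  have [n ne] : exists n : nat, n.+1%:R^-1 < e / 2.
    have := near_infty_natSinv_lt (PosNum e20) => /= -[n _ /(_ n (leqnn n))].
    by exists n.
  (* The coordinates whose truncation bound may exceed [e / 2]. *)
  pose L : seq K := pmap (@unpickle K) (iota 0 n.+1).
  have := @filter_all_seq _ _ (nbhs_filter x) _ L
    (fun k => [set y | `|c k x - c k y| < e / 2]) (fun k _ => coord_near x k e20).
  apply: filterS => y /= H.
  apply: (@le_lt_trans _ _ (e / 2)); last by rewrite ltr_pdivrMr// ltr_pMr// ltr1n.
  apply: dist_le => k; rewrite ge_min; apply/orP.
  case: (leqP n (pickle k)) => kn; last first.
    left; apply/ltW/H; rewrite mem_pmap; apply/mapP; exists (pickle k).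
      by rewrite mem_iota /= add0n ltnS ltnW.
    by rewrite pickleK.
  right; apply: le_trans (ltW ne); rewrite lef_pV2 ?posrE ?ltr0n//.
  by rewrite ler_nat ltnS.
- move=> u cu; apply: coord_complete => k.
  apply/cauchy_cvgP/cauchy_exP => e e0.
  have m0 : 0 < Num.min e (pickle k).+1%:R^-1.
    by rewrite lt_min e0 invr_gt0 ltr0n.
  have [n Hn] := cu _ m0; exists (c k (u n)); exists n => // m nm.
  by rewrite -ball_normE /=; apply/dist_lt/Hn => //=.
Qed.

(** Boxes with rational centers and radii [1/(n+1)]: countably many of them form
    a base. *)
Definition coord_base (i : seq (K * rat) * nat) : set X :=
  [set x | forall kr, kr \in i.1 -> `|c kr.1 x - ratr kr.2| < i.2.+1%:R^-1].

Lemma coord_base_open i : open (coord_base i).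
Proof.
rewrite openE => x Bx; apply: filter_all_seq => kr /Bx H.
have /= := @coord_near x kr.1 (i.2.+1%:R^-1 - `|c kr.1 x - ratr kr.2|).
rewrite subr_gt0 => /(_ H); apply: filterS => y.
rewrite ltrBrDr; apply: le_lt_trans.
by rewrite addrC (distrC (c _ x) (c _ y)) addrC ler_distD.
Qed.

Lemma coord_nbhs x A : nbhs x A -> exists L : seq K, exists2 e : R, 0 < e &
  [set y | forall k, k \in L -> `|c k x - c k y| < e] `<=` A.
Proof.
pose B (Le : seq K * R) := [set y | forall k, k \in Le.1 -> `|c k x - c k y| < Le.2].
pose D := [set Le : seq K * R | 0 < Le.2].
have FF : Filter (filter_from D B).
  apply: filter_from_filter; first by exists ([::], 1); rewrite /D /= ltr01.
  move=> [L e] [M f] /= e0 f0; exists (L ++ M, Num.min e f).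
    by rewrite /D /= lt_min e0.
  move=> y By; split=> k kL; have := By k; rewrite /= mem_cat kL ?orbT lt_min.
    by move=> /(_ isT)/andP[].
  by move=> /(_ isT)/andP[].
have : filter_from D B --> x.
  apply/cvg_coord => k; apply/cvgrPdist_lt => e e0.
  exists ([:: k], e) => // y; apply; exact: mem_head.
by move=> /[apply] -[[L e] /= e0 sub]; exists L, e.
Qed.

Lemma coord_baseP x A : nbhs x A -> exists2 i, coord_base i x & coord_base i `<=` A.
Proof.
move=> /coord_nbhs[L [e e0 sub]].
have e20 : 0 < e / 2 by rewrite divr_gt0.
have [n ne] : exists n : nat, n.+1%:R^-1 < e / 2.
  have := near_infty_natSinv_lt (PosNum e20) => /= -[n _ /(_ n (leqnn n))].
  by exists n.
have rP k : exists r : rat, `|c k x - ratr r| < n.+1%:R^-1.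
  have n0 : 0 < n.+1%:R^-1 :> R by rewrite invr_gt0 ltr0n.
  have /rat_in_itvoo[r] : c k x - n.+1%:R^-1 < c k x + n.+1%:R^-1.
    by rewrite ltrBlDr -addrA ltrDl addr_gt0.
  by rewrite in_itv /= -ltr_distlC => rx; exists r.
have [r rr] := choice rP.
exists ([seq (k, r k) | k <- L], n).
  by move=> _ /mapP[k kL ->] /=.
move=> y By; apply: sub => k kL.
have := By (k, r k); rewrite map_f// => /(_ isT) /= H.
apply: (le_lt_trans (ler_distD (ratr (r k)) _ _)).
rewrite (distrC (ratr _)) (splitr e).
by apply: ltrD; apply: lt_trans ne.
Qed.

Lemma coord_polish : polish R X.
Proof.
split; first by exists coord_dist; exact: coord_dist_metric.
have [[x0 _]|X0] := pselect (exists x : X, True); last first.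
  exists set0; first exact: countable0.
  by move=> O [x]; case: X0; exists x.
exists (range (fun i => xget x0 (coord_base i))).
  exact: sub_countable (card_image_le _ _) (countableP _).
move=> O [x Ox] oO.
have [i Bi sub] := coord_baseP (open_nbhs_nbhs (conj oO Ox)).
have Px : coord_base i (xget x0 (coord_base i)) by apply: xgetPex; exists x.
by exists (xget x0 (coord_base i)); split; [exact: sub|exists i].
Qed.

End coordinates.

(** * The topology of the wreath product *)

Lemma perm_cvg (N : choiceType) (F : set_system (perm N)) (FF : Filter F)
    (p : perm N) :
  F --> p <-> forall n, F [set p' : perm N | p' n = p n].
Proof.
split=> [/initial_cvg/ptws_cvg H n|H].
  by have /discrete_cvg := H n.
apply/initial_cvg/ptws_cvg => n; apply/discrete_cvg; exact: H.
Qed.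

Lemma ppg_cvg (N : countType) (P : polish_perm_group N) (F : set_system P)
    (FF : Filter F) (p : P) :
  F --> p <-> forall n, F [set p' : P | val p' n = val p n].
Proof.
split=> [/initial_cvg/perm_cvg H n|H]; first exact: H.
apply/initial_cvg/perm_cvg => n; exact: H.
Qed.

Section wreath_topology.
Variables P Q : polish_perm_group nat.
Implicit Types g : wreath P Q.

(** The topology of the wreath product, defined as a product of pointwise
    topologies, is that of pointwise convergence of its action on pairs; all
    topological facts on the group are derived from this one. *)
Lemma wreath_cvg (F : set_system (wreath P Q)) (FF : Filter F) g :
  F --> g <-> forall k, F [set g' | wreath_fun g' k = wreath_fun g k].
Proof.
split=> [Fg [n m]|H].
  have F1 : (fst @ F) --> g.1 by apply: cvg_trans (cvg_app _ Fg) _; exact: cvg_fst.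
  have F2 : (snd @ F) --> g.2 by apply: cvg_trans (cvg_app _ Fg) _; exact: cvg_snd.
  have /ppg_cvg/(_ n) F1n := F1.
  have /ptws_cvg/(_ n)/ppg_cvg/(_ m) F2n := F2.
  have {}F1n : F [set g' : wreath P Q | val g'.1 n = val g.1 n] := F1n.
  have {}F2n : F [set g' : wreath P Q | val (g'.2 n) m = val (g.2 n) m] := F2n.
  apply: (@filterS _ F FF _ _ _ (filterI F1n F2n)) => g' /= [e1 e2].
  by rewrite /wreath_fun /= e1 e2.
(* The first component can be read off at any second coordinate, here 0. *)
have F1 : (fst @ F) --> g.1.
  by apply/ppg_cvg => n; apply: (@filterS _ F FF _ _ _ (H (n, 0%N))) => g' /= [].
have F2 : (snd @ F) --> g.2.
  apply/ptws_cvg => n; apply/ppg_cvg => m.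
  by apply: (@filterS _ F FF _ _ _ (H (n, m))) => g' /= [].
move=> A /(cvg_pair F1 F2) /=.
by apply: (@filterS _ F FF) => -[].
Qed.

Lemma wreath_fun_inv g k j : (wreath_fun g^-1%g k = j) <-> (wreath_fun g j = k).
Proof. by split=> <-; [exact: wreath_invK|exact: wreath_funK]. Qed.

Lemma wreath_near g k : \forall g' \near g, wreath_fun g' k = wreath_fun g k.
Proof. by have /wreath_cvg/(_ k) : nbhs g --> g by exact: cvg_id. Qed.

Lemma wreath_mul_continuous :
  continuous (fun gh : wreath P Q * wreath P Q => (gh.1 * gh.2)%g).
Proof.
move=> [g h]; apply/wreath_cvg => k.
have Ng : \forall gh' \near (g, h), wreath_fun gh'.1 (wreath_fun h k) =
    wreath_fun g (wreath_fun h k).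
  exact: (@cvg_fst _ _ (nbhs g) (nbhs h) _ _ (wreath_near g _)).
have Nh : \forall gh' \near (g, h), wreath_fun gh'.2 k = wreath_fun h k.
  exact: (@cvg_snd _ _ (nbhs g) (nbhs h) _ _ (wreath_near h _)).
apply: (@filterS _ _ _ _ _ _ (filterI Ng Nh)) => -[g' h'] /= [e1 e2].
by rewrite !wreath_funM /= e2 e1.
Qed.

Lemma wreath_inv_near g k :
  \forall g' \near g, wreath_fun g'^-1%g k = wreath_fun g^-1%g k.
Proof.
apply: (@filterS _ _ _ _ _ _ (wreath_near g (wreath_fun g^-1%g k))) => g' e.
by apply/wreath_fun_inv; rewrite e wreath_invK.
Qed.

Lemma wreath_inv_continuous : continuous (fun g : wreath P Q => (g^-1)%g).
Proof. by move=> g; apply/wreath_cvg => k; exact: wreath_inv_near. Qed.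

End wreath_topology.

(** A pointwise limit of permutations need not be surjective; pointwise
    convergence of the inverses as well makes the two limits inverse to each
    other. *)
Lemma ppg_cvg_ex (P : polish_perm_group nat) (F : set_system (perm nat))
    (FF : ProperFilter F) : F (ppg_set P) ->
  (forall n, exists m, F [set p : perm nat | p n = m]) ->
  (forall n, exists m, F [set p : perm nat | p^-1%g n = m]) ->
  exists2 p, ppg_set P p & F --> p.
Proof.
move=> FP /choice[f Ff] /choice[f' Ff'].
have fK : cancel f f'.
  move=> n; have [p [<- <-]] := filter_ex (filterI (Ff n) (Ff' (f n))).
  by rewrite /= perm_funK.
have f'K : cancel f' f.
  move=> n; have [p [<- <-]] := filter_ex (filterI (Ff' n) (Ff (f' n))).
  by rewrite /= perm_invK.
have Fp : F --> Perm fK f'K by apply/perm_cvg.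
exists (Perm fK f'K) => //.
exact: (@closed_cvg _ _ F FF id _ (@ppg_closed _ P) FP).
Qed.

Lemma ultra_seq (T : Type) (K : eqType) (F : set_system T) (f : T -> K)
    (L : seq K) : UltraFilter F -> F [set x | f x \in L] ->
  exists m, F [set x | f x = m].
Proof.
move=> FU; elim: L => [|m L IH] FL.
  by have [x] := filter_ex FL.
have [Fm|Fm] := in_ultra_setVsetC [set x | f x = m] FU; first by exists m.
apply: IH; apply: filterS (filterI Fm FL) => x /= [xm].
by rewrite inE => /orP[/eqP//|].
Qed.

Definition infinite_orbit (N : countType) (P : polish_perm_group N) (n : N) :=
  forall L : seq N, exists2 p, ppg_set P p & (p : perm N) n \notin L.

(** If all orbits are finite, an ultrafilter on the group decides every value of
    [p] and of its inverse, hence converges. *)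
Lemma noncompact_infinite_orbit (P : polish_perm_group nat) :
  ~ compact (ppg_set P) -> exists n, infinite_orbit P n.
Proof.
move=> nc; apply: contrapT => /forallNP H; apply: nc.
have fin n : exists L : seq nat, forall p, ppg_set P p -> p n \in L.
  have /existsNP[L HL] := H n; exists L => p Pp.
  by apply/negPn/negP => pn; apply: HL; exists p.
rewrite compact_ultra => F FU FP.
have [||p Pp Fp] := @ppg_cvg_ex P F _ FP; last by exists p.
  move=> n; have [L HL] := fin n; apply: (@ultra_seq _ _ _ _ L FU).
  by apply: filterS FP => p /HL.
move=> n; have [L HL] := fin n; apply: (@ultra_seq _ _ _ _ L FU).
by apply: filterS FP => p /ppgV/HL.
Qed.

Section wreath_polish.
Variables (R : realType) (P Q : polish_perm_group nat).
Implicit Types g : wreath P Q.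

(** The values of the inverse are among the coordinates because otherwise the
    coordinatewise limit could fail to be a permutation. *)
Definition wreath_coord (k : nat * nat + nat * nat) g : R :=
  (pickle match k with
          | inl k => wreath_fun g k
          | inr k => wreath_fun g^-1%g k
          end)%:R.

Lemma natr_dist_lt1 (m n : nat) : `|m%:R - n%:R : R| < 1 -> m = n.
Proof.
rewrite -[m%:R]/(m%:Z%:~R) -[n%:R]/(n%:Z%:~R) -intrB -intr_norm -[1]/(1%:~R) ltr_int.
lia.
Qed.

Lemma wreath_coord_cvg (F : set_system (wreath P Q)) g : Filter F ->
  F --> g <-> forall k, wreath_coord k @ F --> wreath_coord k g.
Proof.
move=> FF; split=> [Fg k|H].
  apply/cvgrPdist_lt => e e0.
  have : F [set g' | wreath_coord k g' = wreath_coord k g].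
    case: k => k.
      by apply: filterS (Fg _ (wreath_near g k)) => g' /= e'; rewrite /wreath_coord e'.
    by apply: filterS (Fg _ (wreath_inv_near g k)) => g' /= e'; rewrite /wreath_coord e'.
  by apply: filterS => g' /= e'; rewrite e' subrr normr0.
apply/wreath_cvg => k; have /cvgrPdist_lt/(_ 1 ltr01) := H (inl k).
by apply: filterS => g' /natr_dist_lt1/(pcan_inj pickleK).
Qed.

Lemma wreath_coord_inj g h :
  (forall k, wreath_coord k g = wreath_coord k h) -> g = h.
Proof.
move=> H; have e k : wreath_fun g k = wreath_fun h k.
  by apply: (pcan_inj (@pickleK _)); apply: natr_dist_lt1; have := H (inl k);
  rewrite /wreath_coord => ->; rewrite subrr normr0.
case: g h e {H} => [p q] [p' q'] /= e; congr pair.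
  by apply/val_inj/perm_ext => n; have [] := e (n, 0%N).
by apply/funext => n; apply/val_inj/perm_ext => m; have [] := e (n, m).
Qed.

Lemma wreath_coord_complete (u : nat -> wreath P Q) :
  (forall k, cvgn (wreath_coord k \o u)) -> exists l : wreath P Q, u @ \oo --> l.
Proof.
move=> H.
pose out (g : wreath P Q) k := match k with
  | inl k => wreath_fun g k
  | inr k => wreath_fun g^-1%g k
  end.
have ev k : exists j, \forall n \near \oo, out (u n) k = j.
  have e0 : 0 < 2^-1 :> R by rewrite invr_gt0.
  have /cvgrPdist_lt/(_ _ e0)[N _ HN] := H k.
  have {}HN n : (N <= n)%N ->
      `|limn (wreath_coord k \o u) - (pickle (out (u n) k))%:R| < 2^-1.
    exact: HN.
  exists (out (u N) k); exists N => // n /= /HN Hn.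
  apply: (pcan_inj (@pickleK _)); apply: natr_dist_lt1.
  apply: (le_lt_trans (ler_distD (limn (wreath_coord k \o u)) _ _)).
  rewrite [ltRHS](splitr 1) mul1r; apply: ltrD; last exact: HN.
  by rewrite distrC.
have {ev} [f Hf] := choice ev.
have limit (v : nat -> perm nat) (A : polish_perm_group nat) :
    (forall n, ppg_set A (v n)) ->
    (forall i, exists j, \forall n \near \oo, v n i = j) ->
    (forall i, exists j, \forall n \near \oo, (v n)^-1%g i = j) ->
    exists a : A, forall i, \forall n \near \oo, v n i = val a i.
  move=> Av v1 v2.
  have vA : (v @ \oo) (ppg_set A) by exists 0%N => // n _; exact: Av.
  have [p Ap vp] := ppg_cvg_ex _ vA v1 v2.
  exists (SigSub (mem_set Ap)) => i.
  by have /perm_cvg/(_ i) := vp.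
have [p Hp] : exists p : P, forall i, \forall n \near \oo, val (u n).1 i = val p i.
  apply: (limit (fun n => val (u n).1)); first by move=> n; exact: ppg_in.
    move=> i; exists (f (inl (i, 0%N))).1.
    by apply: filterS (Hf (inl (i, 0%N))) => n /= <-.
  move=> i; exists (f (inr (i, 0%N))).1.
  by apply: filterS (Hf (inr (i, 0%N))) => n /= <-.
have /choice[q Hq] i : exists q : Q, forall j, \forall n \near \oo,
    val ((u n).2 i) j = val q j.
  apply: (limit (fun n => val ((u n).2 i))); first by move=> n; exact: ppg_in.
    move=> j; exists (f (inl (i, j))).2.
    by apply: filterS (Hf (inl (i, j))) => n /= <-.
  (* The inverse of [g] maps row [p i] back to row [i] by the inverse of the
     [i]-th component of [g]. *)
  move=> j; exists (f (inr (val p i, j))).2.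
  apply: filterS (filterI (Hf (inr (val p i, j))) (Hp i)) => n /= [<- <-] /=.
  by rewrite /wreath_inv /= perm_funK.
exists (p, q : {ptws nat -> Q}); apply/wreath_cvg => -[i j].
apply: filterS (filterI (Hp i) (Hq i j)) => n /= [e1 e2].
by rewrite /wreath_fun /= e1 e2.
Qed.

Lemma wreath_polish_group : polish_group R (wreath P Q).
Proof.
split; [|exact: wreath_mul_continuous|exact: wreath_inv_continuous].
exact: (coord_polish (inl (0%N, 0%N)) wreath_coord_cvg wreath_coord_inj
  wreath_coord_complete).
Qed.

End wreath_polish.

(** * Category *)

Lemma comeager_bigcap (X : topologicalType) (I : countType) (W : I -> set X) :
  (forall i, open (W i)) -> (forall i, dense (W i)) ->
  comeager (\bigcap_i W i).
Proof.
move=> oW dW.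
exists (fun n => if unpickle n is Some i then ~` W i else set0).
  move=> n; case: unpickle => [i|]; rewrite /nowhere_dense; last first.
    by rewrite closure0 interior0.
  rewrite -(closure_id _).1; last exact: open_closedC.
  apply/seteqP; split=> // x xW.
  have [y [Wy Wy']] := dW i _ (ex_intro _ x xW) (@open_interior _ _).
  exact: (interior_subset Wy).
move=> x /existsNP[i /not_implyP[_ Wx]].
by exists (pickle i) => //=; rewrite pickleK.
Qed.

Lemma comeager_dense_open (X : topologicalType) (C : set X) : comeager C ->
  exists W : nat -> set X, [/\ forall n, open (W n), forall n, dense (W n) &
    \bigcap_n W n `<=` C].
Proof.
move=> [F nF sF]; exists (fun n => ~` closure (F n)); split.
- by move=> n; apply/closed_openC/closed_closure.
- move=> n O [x Ox] oO; apply: contrapT => nO.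
  suff : (closure (F n))° x by rewrite nF.
  rewrite /interior nbhsE; exists O => // y Oy; apply: contrapT => nFy; apply: nO; by exists y.
- move=> x Wx; apply: contrapT => /sF[n _ Fx].
  exact: (Wx n I (subset_closure Fx)).
Qed.

(** Nested balls of radii at most [1/(n+1)], the [n]-th step staying inside the
    [n]-th dense open set. *)
Lemma baire (R : realType) (X : topologicalType) (x0 : X) (J : countType)
    (W : J -> set X) :
  polish R X -> (forall j, open (W j)) -> (forall j, dense (W j)) ->
  exists x, forall j, W j x.
Proof.
move=> [[d [d0 dC dT dN dcomplete]] _] oWJ dWJ.
pose W' n := if unpickle n is Some j then W j else setT.
have oW n : open (W' n) by rewrite /W'; case: unpickle => //; exact: openT.
have dW n : dense (W' n).
  rewrite /W'; case: unpickle => // O [x Ox] _; by exists x.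
suff [x Wx] : exists x, forall n, W' n x.
  by exists x => j; have := Wx (pickle j); rewrite /W' pickleK.
clearbody W' => {W oWJ dWJ}.
have dxx x : d x x = 0 by exact/d0.
have ball_open x r : open [set z | d x z < r].
  rewrite openE => y /= xy; apply/dN; exists (r - d x y); first by rewrite subr_gt0.
  by move=> z /=; rewrite ltrBrDl; apply: le_lt_trans.
have step n (s : X * R) : exists s' : X * R, 0 < s.2 -> [/\ 0 < s'.2,
    s'.2 <= n.+1%:R^-1 &
    forall z, d s'.1 z <= s'.2 -> d s.1 z < s.2 /\ W' n z].
  have [s0|] := boolP (0 < s.2); last by exists s.
  have [||y [sy Wy]] := @dW n [set z | d s.1 z < s.2].
  - by exists s.1; rewrite /= dxx.
  - exact: ball_open.
  have [e e0 sub] : exists2 e, 0 < e &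
      [set z | d y z < e] `<=` [set z | d s.1 z < s.2] `&` W' n.
    apply/dN; apply: filterI; apply: open_nbhs_nbhs; split=> //.
  have n0 : 0 < n.+1%:R^-1 :> R by rewrite invr_gt0 ltr0n.
  exists (y, Num.min (e / 2) n.+1%:R^-1) => _ /=; split.
  - by rewrite lt_min n0 divr_gt0.
  - by rewrite ge_min lexx orbT.
  - move=> z; rewrite le_min => /andP[ze _]; apply: sub => /=.
    by apply: le_lt_trans ze _; rewrite ltr_pdivrMr// ltr_pMr// ltr1n.
have /choice[f Hf] : forall ns : nat * (X * R), exists s' : X * R, 0 < ns.2.2 ->
    [/\ 0 < s'.2, s'.2 <= ns.1.+1%:R^-1 &
      forall z, d s'.1 z <= s'.2 -> d ns.2.1 z < ns.2.2 /\ W' ns.1 z].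
  by move=> [n s]; exact: step.
pose s := fix s n := if n is m.+1 then f (m, s m) else (x0, 1) : X * R.
have s0 n : 0 < (s n).2.
  by elim: n => [|n IH] //=; have [] := Hf (n, s n) IH.
have sS n : (s n.+1).2 <= n.+1%:R^-1 by have [] := Hf (n, s n) (s0 n).
have sW n z : d (s n.+1).1 z <= (s n.+1).2 -> d (s n).1 z < (s n).2 /\ W' n z.
  by have [_ _] := Hf (n, s n) (s0 n); apply.
have nest m n z : d (s (m + n)%N).1 z <= (s (m + n)%N).2 -> d (s n).1 z <= (s n).2.
  elim: m => [|m IH] //; rewrite addSn => /sW[/ltW lt _]; exact: IH.
have near_center k m : (k <= m)%N -> d (s k).1 (s m).1 <= (s k).2.
  by move=> km; apply: (@nest (m - k)%N); rewrite subnK// dxx ltW.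
have [e e0|l sl] := dcomplete (fun n => (s n).1).
  have e20 : 0 < e / 2 by rewrite divr_gt0.
  have [k _ /(_ k (leqnn k)) /= ke] := near_infty_natSinv_lt (PosNum e20).
  exists k.+1 => m n km kn.
  apply: le_lt_trans (dT _ (s k.+1).1 _) _; rewrite dC (splitr e).
  apply: ltrD; apply: le_lt_trans ke; apply: le_trans (sS k); exact: near_center.
exists l => n; suff /sW[] : d (s n.+1).1 l <= (s n.+1).2 by [].
apply/ler_addgt0Pl => e e0.
have [k _ Hk] : \forall k \near \oo, d l (s k).1 < e.
  by apply: (sl [set z | d l z < e]); apply/dN; exists e.
pose m := (maxn k n.+1).
apply: le_trans (dT _ (s m).1 _) _; rewrite addrC; apply: lerD.
  by rewrite dC; apply/ltW/Hk; rewrite /= leq_maxl.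
by apply: near_center; rewrite leq_maxr.
Qed.

(** The laws of [mix] say that [X] is a product [X1 * X2], where [mix x u] takes its
    first component from [x] and its second one from [u].  Working with [mix]
    avoids naming the factors. *)
Section rectangular_band.
Variables (R : realType) (X : topologicalType) (x0 : X).
Variables (I : countType) (B : I -> set X).
Hypothesis polishX : polish R X.
Hypothesis B_open : forall i, open (B i).
Hypothesis B_base : forall x A, nbhs x A -> exists2 i, B i x & B i `<=` A.
Variable mix : X -> X -> X.
Hypothesis mixl_continuous : forall u, continuous (mix ^~ u).
Hypothesis mixr_continuous : forall x, continuous (mix x).
Hypothesis mixxx : forall x, mix x x = x.
Hypothesis mix_mix : forall a b c d, mix (mix a b) (mix c d) = mix a d.

(** A dense open set meets every box [O * B i], so those [x] whose section meets
    [B i] form a dense set; it is open because [u] can be kept while [x] varies. *)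
Lemma section_dense_generic (W : set X) (i : I) : open W -> dense W ->
  open [set x | B i !=set0 -> exists2 u, B i u & W (mix x u)] /\
  dense [set x | B i !=set0 -> exists2 u, B i u & W (mix x u)].
Proof.
move=> oW dW; split.
  rewrite openE => x Wx; have [[u0 Bu0]|nB] := pselect (B i !=set0); last first.
    by apply: filterS filterT => y _ /nB.
  have [u Bu Wxu] := Wx (ex_intro _ _ Bu0).
  have : nbhs x (mix ^~ u @^-1` W).
    by apply: mixl_continuous; apply: open_nbhs_nbhs.
  by apply: filterS => y Wyu _; exists u.
move=> O [a Oa] oO.
have [[u Bu]|nB] := pselect (B i !=set0); last by exists a; split=> // /nB.
(* [mix a u] is the point of the box with components in [O] and in [B i]. *)
have ea : mix (mix a u) a = a by rewrite -{2}(mixxx a) mix_mix mixxx.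
have eu : mix u (mix a u) = u by rewrite -{1}(mixxx u) mix_mix mixxx.
have Nl : nbhs (mix a u) (mix ^~ a @^-1` O).
  by apply: mixl_continuous; rewrite ea; exact: open_nbhs_nbhs.
have Nr : nbhs (mix a u) (mix u @^-1` B i).
  by apply: mixr_continuous; rewrite eu; apply: open_nbhs_nbhs.
have : nbhs (mix a u) (mix ^~ a @^-1` O `&` mix u @^-1` B i) by exact: filterI.
rewrite nbhsE => -[V [oV Vau] Vsub].
have [w [/Vsub[/= Ow Bw] Ww]] : V `&` W !=set0 by apply: dW oV; exists (mix a u).
exists (mix w a); split=> // _; exists (mix u w) => //.
by rewrite mix_mix mixxx.
Qed.

(** The form of the Kuratowski-Ulam theorem that is needed: for generic [x] the
    sections of all [W j] are dense, and then the sections at any two such points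
    have a common element by the Baire category theorem. *)
Lemma generic_mix (J : countType) (W : J -> set X) :
  (forall j, open (W j)) -> (forall j, dense (W j)) ->
  exists D : set X, [/\ comeager D, D `<=` \bigcap_j W j &
    forall x y, D x -> D y ->
      exists u, forall j, W j (mix x u) /\ W j (mix y u)].
Proof.
move=> oW dW.
pose D (k : J + J * I) := match k with
  | inl j => W j
  | inr (j, i) => [set x | B i !=set0 -> exists2 u, B i u & W j (mix x u)]
  end.
exists (\bigcap_k D k); split.
- apply: comeager_bigcap => -[j|[j i]] //=;
    have [] := @section_dense_generic (W j) i (oW j) (dW j) => //.
- by move=> x Dx j _; exact: (Dx (inl j)).
- move=> x y Dx Dy.
  pose Wxy (k : J + J) := match k with
    | inl j => mix x @^-1` W j
    | inr j => mix y @^-1` W j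
    end.
  have oWxy k : open (Wxy k).
    by case: k => j; apply: open_comp => // a _; exact: mixr_continuous.
  have dWxy k : dense (Wxy k).
    move=> O [v Ov] oO; have [i Bv BO] := B_base (open_nbhs_nbhs (conj oO Ov)).
    have Bi : B i !=set0 by exists v.
    case: k => j.
      by have [u /BO Ou Wu] := Dx (inr (j, i)) Logic.I Bi; exists u.
    by have [u /BO Ou Wu] := Dy (inr (j, i)) Logic.I Bi; exists u.
  have [u Hu] := baire x0 polishX oWxy dWxy.
  by exists u => j; split; [exact: (Hu (inl j))|exact: (Hu (inr j))].
Qed.

End rectangular_band.

(** * Moving finite sets off finite sets *)

Section permutation_groups.
Variables (N : countType) (P : polish_perm_group N).

Lemma infinite_orbit_act (p : perm N) n : ppg_set P p ->
  infinite_orbit P n -> infinite_orbit P (p n).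
Proof.
move=> Pp Hn L; have [r Pr rL] := Hn L.
exists (r * p^-1)%g; first by apply: ppgM => //; exact: ppgV.
by rewrite /= perm_funK.
Qed.

(** The lemma of Neumann.  Let [c] be a new point to be moved off [Del] and [h0 c]
    a point of its orbit outside [Del].  A group element [g] that moves the other
    points off [Del] and off certain translates [h Del] can be corrected, if it
    maps [c] into [Del], by the inverse of an [h] with [h (h0 c) = g c]: this sends
    [c] to [h0 c] and keeps the others off [Del].  Since [g c] then lies in the
    finite set [Del], finitely many translates suffice. *)
Lemma neumann_separation (Gam Del : seq N) :
  (forall n, n \in Gam -> infinite_orbit P n) ->
  exists2 p, ppg_set P p & forall n, n \in Gam -> (p : perm N) n \notin Del.
Proof.
elim: Gam Del => [|c Gam IH] Del inf.
  by exists 1%g => //; exact: ppg1.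
have [h0 Ph0 h0c] := inf c (mem_head _ _) Del.
have /choice[h Hh] d : exists h : perm N, ppg_set P h /\
    ((exists2 r, ppg_set P r & (r : perm N) (h0 c) = d) -> h (h0 c) = d).
  have [[r Pr rd]|no] :=
    pselect (exists2 r, ppg_set P r & (r : perm N) (h0 c) = d).
    by exists r.
  by exists 1%g; split=> [|/no//]; exact: ppg1.
have [|g Pg gDel] := IH (Del ++ [seq h d e | d <- Del, e <- Del]).
  by move=> n nG; apply: inf; rewrite inE nG orbT.
have [gc|gc] := boolP (g c \in Del); last first.
  exists g => // n; rewrite inE => /orP[/eqP->//|/gDel].
  by rewrite mem_cat negb_or => /andP[].
have [Phd hd] := Hh (g c).
have {}hd : h (g c) (h0 c) = g c.
  apply: hd; exists (g * h0^-1)%g; last by rewrite /= perm_funK.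
  by apply: ppgM => //; exact: ppgV.
exists ((h (g c))^-1 * g)%g; first by apply: ppgM => //; exact: ppgV.
move=> n; rewrite inE => /orP[/eqP->|nG].
  by rewrite /= -[X in perm_inv _ X]hd perm_funK.
apply: contra (gDel n nG) => hgn; rewrite mem_cat; apply/orP; right.
apply/allpairsP; exists (g c, perm_inv (h (g c)) (g n)); split=> //=.
by rewrite perm_invK.
Qed.

End permutation_groups.

Definition absorbing (P : polish_perm_group nat) (S : set nat) :=
  forall F : seq nat, (forall n, n \in F -> infinite_orbit P n) ->
  exists2 p, ppg_set P p & forall n, n \in F -> S ((p : perm nat) n).

(** Let [F m] be the set of points below [m] with infinite orbit.  Moving the
    sets [F m] successively to pairwise disjoint places, one gives the
    even-numbered images to [S] and the odd-numbered ones to its complement. *)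
Lemma absorbing_split (P : polish_perm_group nat) :
  exists S, absorbing P S /\ absorbing P (~` S).
Proof.
have /choice[c Hc] (FL : seq nat * seq nat) : exists p : perm nat,
    ppg_set P p /\ forall n, n \in FL.1 -> infinite_orbit P n -> p n \notin FL.2.
  have [|p Pp H] := @neumann_separation _ P [seq n <- FL.1 | `[< infinite_orbit P n >]] FL.2.
    by move=> n; rewrite mem_filter => /andP[/asboolP].
  exists p; split=> // n nF nI; apply: H; rewrite mem_filter nF andbT.
  exact/asboolP.
pose used := fix used m := if m is n.+1
  then used n ++ [seq c (iota 0 n, used n) i | i <- iota 0 n] else [::].
pose p m := c (iota 0 m, used m).
have Pp m : ppg_set P (p m) by have [] := Hc (iota 0 m, used m).
have pnew m i : (i < m)%N -> infinite_orbit P i -> p m i \notin used m.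
  move=> im; have [_] := Hc (iota 0 m, used m); apply.
  by rewrite mem_iota.
have pused m i k : (i < m)%N -> (m < k)%N -> p m i \in used k.
  move=> im; elim: k => // k IH; rewrite ltnS leq_eqVlt /= mem_cat.
  case/orP => [/eqP <-|/IH->//]; apply/orP; right; apply/mapP; exists i => //.
  by rewrite mem_iota.
have pdisj m m' i i' : m != m' -> (i < m)%N -> (i' < m')%N ->
    infinite_orbit P i -> infinite_orbit P i' -> p m i != p m' i'.
  move=> mm im im' ii ii'; apply/eqP => e.
  move: mm; rewrite neq_ltn => /orP[mm|mm].
  - by move: (pnew _ _ im' ii'); rewrite -e pused.
  - by move: (pnew _ _ im ii); rewrite e pused.
have bound (F : seq nat) : exists m, forall n, n \in F -> (n < m)%N.
  exists (\max_(n <- F) n).+1 => n nF; rewrite ltnS.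
  exact: leq_bigmax_seq.
exists [set x | exists m i, [/\ ~~ odd m, (i < m)%N, infinite_orbit P i & x = p m i]].
split=> F inf; have [m Hm] := bound F.
  exists (p m.*2) => // n nF; exists m.*2, n; split=> //.
  - by rewrite odd_double.
  - by have := Hm n nF; lia.
  - exact: inf.
exists (p m.*2.+1) => // n nF [m' [i [om im ii e]]].
have := @pdisj m.*2.+1 m' n i _ _ im (inf n nF) ii; rewrite e eqxx => H.
suff : false by []. apply: H.
  by apply: contraNneq om => <-; rewrite /= odd_double.
by have := Hm n nF; lia.
Qed.

(** * The subshift and its orbits *)

Section subshift.
Variables (R : realType) (P Q : polish_perm_group nat).

Let A := infinite_orbit P.
Let B := infinite_orbit Q.

Definition infinite_part (k : nat * nat) := A k.1 /\ B k.2.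

(** Real arrays supported on the pairs whose two coordinates have infinite orbits;
    entries over finite orbits would be obstructions to connectedness. *)
Definition subshift : set {ptws nat * nat -> R} :=
  [set x | forall k, ~ infinite_part k -> x k = 0].

Lemma infinite_part_act (g : wreath P Q) k :
  infinite_part k -> infinite_part (wreath_fun g k).
Proof. by move=> [Ak Bk]; split; apply: infinite_orbit_act => //; exact: ppg_in. Qed.

Lemma infinite_part_act_inv (g : wreath P Q) k :
  infinite_part (wreath_fun g k) -> infinite_part k.
Proof. by move=> /(infinite_part_act g^-1%g); rewrite wreath_funK. Qed.

Lemma subshift_invariant : invariant_set (@wreath_bernoulli R nat nat P Q) subshift.
Proof.
move=> g x Yx k nk; apply: Yx => /(infinite_part_act g).
by rewrite /= wreath_invK.
Qed.

Lemma subshift_closed : closed subshift.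
Proof.
move=> x clx k nk; apply/eqP; rewrite -normr_le0 leNgt; apply/negP => e0.
have ev : nbhs x [set y : {ptws nat * nat -> R} | `|x k - y k| < `|x k|].
  have /ptws_cvg/(_ k)/cvgrPdist_lt/(_ _ e0) : nbhs x --> x by exact: cvg_id.
  exact.
have [y [/(_ k nk) Yy /=]] := clx _ ev.
by rewrite Yy subr0 ltxx.
Qed.

Let Y : topologicalType := set_type subshift.

Let shift : wreath P Q -> Y -> Y := restr_act subshift_invariant.

Definition entry (k : nat * nat) (y : Y) : R := (val y : {ptws nat * nat -> R}) k.

Lemma entry_cvg (F : set_system Y) (y : Y) : Filter F ->
  F --> y <-> forall k, entry k @ F --> entry k y.
Proof.
move=> FF; split=> [/initial_cvg/ptws_cvg H k|H]; first exact: H.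
by apply/initial_cvg/ptws_cvg => k; exact: H.
Qed.

Lemma entry_inj (x y : Y) : (forall k, entry k x = entry k y) -> x = y.
Proof. by move=> H; apply/val_inj/funext. Qed.

Lemma entry0 k (y : Y) : ~ infinite_part k -> entry k y = 0.
Proof. exact: (set_mem (valP y)). Qed.

Lemma restrict_subshift (x : nat * nat -> R) :
  subshift (fun k => if `[< infinite_part k >] then x k else 0).
Proof. by move=> k nk /=; case: asboolP. Qed.

Definition mk_subshift (x : nat * nat -> R) : Y :=
  SigSub (mem_set (restrict_subshift x)).

Lemma entry_mk (x : nat * nat -> R) k :
  infinite_part k -> entry k (mk_subshift x) = x k.
Proof. by move=> Ik; rewrite /entry /=; case: asboolP. Qed.

Lemma entry_complete (u : nat -> Y) :
  (forall k, cvgn (entry k \o u)) -> exists l : Y, u @ \oo --> l.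
Proof.
move=> cu; exists (mk_subshift (fun k => limn (entry k \o u))).
apply/entry_cvg => k; have [Ik|nk] := pselect (infinite_part k).
  by rewrite entry_mk //; exact: cu.
rewrite entry0 //; apply: cvg_near_cst; apply: nearW => n.
exact: entry0.
Qed.

Lemma entry_near k (y : Y) (e : R) : 0 < e ->
  \forall y' \near y, `|entry k y - entry k y'| < e.
Proof. exact: (coord_near entry_cvg). Qed.

Lemma subshift_polish : polish R Y.
Proof. exact: (coord_polish (0%N, 0%N) entry_cvg entry_inj entry_complete). Qed.

Lemma entry_shift (g : wreath P Q) k y :
  entry k (shift g y) = entry (wreath_fun g^-1%g k) y.
Proof. by []. Qed.

Lemma entry_shift_inv (h : wreath P Q) k y :
  entry k (shift h^-1%g y) = entry (wreath_fun h k) y.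
Proof. by rewrite entry_shift invgK. Qed.

Lemma subshift_polish_Gspace : polish_Gspace shift R.
Proof.
split.
- exact: wreath_polish_group.
- exact: subshift_polish.
- by move=> y; apply: entry_inj => k; rewrite -invg1 entry_shift_inv wreath_fun1.
- move=> g h y; apply: entry_inj => k.
  by rewrite -[g]invgK -[h]invgK -invgM !entry_shift_inv.
- move=> [g y]; apply/entry_cvg => k; apply/cvgrPdist_lt => e e0 /=.
  have Ng : \forall gy \near (g, y), wreath_fun gy.1^-1%g k = wreath_fun g^-1%g k.
    exact: (@cvg_fst _ _ (nbhs g) (nbhs y) _ _ (wreath_inv_near g _)).
  have Ny : \forall gy \near (g, y),
      `|entry (wreath_fun g^-1%g k) y - entry (wreath_fun g^-1%g k) gy.2| < e.
    exact: (@cvg_snd _ _ (nbhs g) (nbhs y) _ _ (entry_near _ _ e0)).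
  apply: (@filterS _ _ _ _ _ _ (filterI Ng Ny)) => -[g' y'] /= [e1].
  by rewrite !entry_shift e1.
Qed.

(** The entries of a point of the orbit of [y] are entries of [y]; hence at a fixed
    position of the infinite part they range over a countable set, while arbitrary
    small changes of that entry stay in the subshift. *)
Lemma orbit_meager a b y : A a -> B b -> meager (orbit_set shift y).
Proof.
move=> Aa Bb; pose E n := [set z : Y | if unpickle n is Some k
  then entry (a, b) z = entry k y else False].
exists E; last first.
  move=> _ [g _ <-]; exists (pickle (wreath_fun g^-1%g (a, b))) => //.
  by rewrite /E /= pickleK.
move=> n; apply/seteqP; split=> // z Ez.
have [L [e e0 Le]] := coord_nbhs entry_cvg Ez.
pose z' := mk_subshift (fun k => entry k z + e / 2).
(* Points of the closure have an entry close to the fixed value [entry k y],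
   which [z] and its perturbation [z'] cannot both have. *)
have clE w : closure (E n) w -> exists2 k,
    unpickle n = Some k & `|entry (a, b) w - entry k y| < e / 4.
  have e40 : 0 < e / 4 by rewrite divr_gt0.
  move=> /(_ _ (entry_near (a, b) w e40))[w' []]; rewrite /E /=.
  by case: unpickle => // k ew' ew; exists k; rewrite // -ew'.
have [k nk zk] := clE z (nbhs_singleton Ez).
have [|k' nk' zk'] := clE z'.
  apply: Le => l _; have [Il|nl] := pselect (infinite_part l); last first.
    by rewrite !entry0 // subrr normr0.
  rewrite entry_mk // opprD addNKr normrN gtr0_norm ?divr_gt0 //.
  by rewrite ltr_pdivrMr // ltr_pMr // ltr1n.
move: nk' zk'; rewrite nk => -[<-]; rewrite entry_mk; last by split.
move: zk; rewrite !ltr_distl => /andP[? ?] /andP[? ?]; lra.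
Qed.

(** Row [a] of [y] has a dense orbit in the shift of [Q] on the real sequences
    supported on the points with infinite orbit. *)
Definition row_dense (a : nat) (y : Y) :=
  forall (t : nat -> R) (L : seq nat) (e : R), 0 < e ->
  exists2 q, ppg_set Q q &
    forall b, b \in L -> B b -> `|entry (a, (q : perm nat) b) y - t b| < e.

(** [row_dense] cut into countably many conditions: a rational target, given by the
    list [i.2.1], and the precision [1/(i.2.2+1)]. *)
Definition row_approx (i : (nat * seq nat) * (seq rat * nat)) : set Y :=
  [set y | A i.1.1 -> exists2 q, ppg_set Q q &
    forall b, b \in i.1.2 -> B b ->
      `|entry (i.1.1, (q : perm nat) b) y - ratr (nth 0 i.2.1 b)| < i.2.2.+1%:R^-1].

Lemma row_approx_open i : open (row_approx i).
Proof.
case: i => -[a L] [r n]; rewrite openE => y /=.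
have [Aa|nA] := pselect (A a); last by move=> _; apply: filterE => z /nA.
move=> /(_ Aa)[q Qq Hq].
have : \forall z \near y, forall b, b \in L -> B b ->
    `|entry (a, (q : perm nat) b) z - ratr (nth 0 r b)| < n.+1%:R^-1.
  apply: filter_all_seq => b bL.
  have [Bb|nB] := pselect (B b); last by apply: filterE => z /nB.
  have := Hq b bL Bb; rewrite -subr_gt0 => /(entry_near (a, q b) y).
  apply: filterS => z; rewrite ltrBrDr => Hz _.
  apply: le_lt_trans Hz.
  by rewrite (distrC (entry _ y) (entry _ z)) ler_distD.
by apply: filterS => z Hz _; exists q.
Qed.

(** By the lemma of Neumann, [q] can move the finitely many prescribed positions
    off those which determine a neighborhood of [y], so the entries of row [a] at
    the new positions can be set to the target. *)
Lemma row_approx_dense i : dense (row_approx i).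
Proof.
case: i => -[a L] [r n] O [y Oy] oO.
have [M [e e0 Me]] := coord_nbhs entry_cvg (open_nbhs_nbhs (conj oO Oy)).
pose L' := [seq b <- L | `[< B b >]].
have L'B b : b \in L' -> B b by rewrite mem_filter => /andP[/asboolP].
have [q Qq qM] := neumann_separation [seq k.2 | k <- M] L'B.
pose x (k : nat * nat) := if (k.1 == a) && (q^-1%g k.2 \in L')
  then ratr (nth 0 r (q^-1%g k.2)) else entry k y.
exists (mk_subshift x); split.
  apply: Me => k kM; have [Ik|nk] := pselect (infinite_part k); last first.
    by rewrite !entry0 // subrr normr0.
  rewrite entry_mk // /x; case: ifP => [/andP[_ /qM]|_]; last by rewrite subrr normr0.
  by rewrite perm_invK map_f.
move=> /= Aa; exists q => // b bL Bb.
rewrite entry_mk; last by split=> //; exact: infinite_orbit_act.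
rewrite /x /= eqxx perm_funK mem_filter bL andbT.
by case: asboolP => // _; rewrite subrr normr0 invr_gt0 ltr0n.
Qed.

Lemma row_approxP y a : (forall i, row_approx i y) -> A a -> row_dense a y.
Proof.
move=> H Aa t L e e0.
have e20 : 0 < e / 2 by rewrite divr_gt0.
have [n _ /(_ n (leqnn n)) /= ne] := near_infty_natSinv_lt (PosNum e20).
have /choice[r rt] b : exists r : rat, `|ratr r - t b| < e / 2.
  have /rat_in_itvoo[r] : t b - e / 2 < t b + e / 2.
    by rewrite ltrBlDr -addrA ltrDl addr_gt0.
  by rewrite in_itv /= -ltr_distl => rx; exists r.
have [q Qq Hq] := H ((a, L), (mkseq r (\max_(b <- L) b).+1, n)) Aa.
exists q => // b bL Bb; have := Hq b bL Bb; rewrite /= nth_mkseq; last first.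
  by rewrite ltnS; exact: leq_bigmax_seq.
move=> H1; apply: (le_lt_trans (ler_distD (ratr (r b)) _ _)).
by rewrite (splitr e); apply: ltrD => //; exact: lt_trans ne.
Qed.

Definition rows_dense y := forall a, A a -> row_dense a y.

Lemma rows_dense_shift (h : wreath P Q) y :
  rows_dense y -> rows_dense (shift h^-1%g y).
Proof.
move=> dy a Aa t L e e0.
have [|q Qq Hq] := dy (val h.1 a) _ t L e e0.
  by apply: infinite_orbit_act => //; exact: ppg_in.
exists ((val (h.2 a))^-1 * q)%g.
  by apply: ppgM => //; apply: ppgV; exact: ppg_in.
by move=> b bL Bb; rewrite entry_shift_inv /wreath_fun /= perm_invK; exact: Hq.
Qed.

Lemma nbhs1_wreath (V : set (wreath P Q)) : nbhs 1%g V ->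
  exists L : seq (nat * nat), forall g : wreath P Q,
    (forall k, k \in L -> wreath_fun g k = k) -> V g.
Proof.
move=> /(coord_nbhs (@wreath_coord_cvg R P Q))[L [e e0 sub]].
exists [seq match k with inl k | inr k => k end | k <- L] => g gL.
apply: sub => k kL; suff -> : wreath_coord R k g = wreath_coord R k (1%g : wreath P Q).
  by rewrite subrr normr0.
have := gL _ (map_f _ kL).
case: k kL => k _ gk; rewrite /wreath_coord ?invg1 wreath_fun1 ?gk //.
by congr (pickle _)%:R; apply/wreath_fun_inv.
Qed.

(** [V] contains every element that acts trivially on the base and in the finitely
    many rows that [L] mentions.  Such elements can move the remaining rows
    independently of each other, so if the rows of [w] have dense orbits, agreement
    in those finitely many rows is enough. *)
Lemma closure_translates (V : set (wreath P Q)) (L : seq (nat * nat)) w w' :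
  (forall g : wreath P Q, (forall k, k \in L -> wreath_fun g k = k) -> V g) ->
  rows_dense w ->
  (forall k, k.1 \in [seq k.1 | k <- L] -> entry k w = entry k w') ->
  closure (translates shift V w) w'.
Proof.
move=> VL dw ww' O /(coord_nbhs entry_cvg)[M [e e0 sub]].
have /choice[q Hq] a : exists q : Q,
    (a \in [seq k.1 | k <- L] -> q = 1%g) /\
    forall b, b \in [seq k.2 | k <- M] -> infinite_part (a, b) ->
      `|entry (a, val q b) w - entry (a, b) w'| < e.
  have [aL|naL] := boolP (a \in [seq k.1 | k <- L]).
    by exists 1%g; split=> // b _ _; rewrite /= ww' // subrr normr0.
  have [Aa|nA] := pselect (A a); last by exists 1%g; split=> // b _ [].
  have [q Qq Hq] := dw a Aa (fun b => entry (a, b) w') [seq k.2 | k <- M] e e0.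
  by exists (SigSub (mem_set Qq)); split=> // b bM [_ Bb]; exact: Hq.
pose h : wreath P Q := (1%g, q : {ptws nat -> Q}).
exists (shift h^-1%g w); split.
  exists h^-1%g => //; apply: VL => k kL; apply/wreath_fun_inv.
  have [q1 _] := Hq k.1; rewrite /wreath_fun /= q1 ?map_f //=.
  by case: k kL q1.
apply: sub => k kM; rewrite entry_shift_inv.
have [Ik|nk] := pselect (infinite_part k); last first.
  by rewrite !entry0 ?subrr ?normr0 // => /infinite_part_act_inv.
rewrite distrC; have [_] := Hq k.1; case: k kM Ik => a b kM Ik; apply=> //=.
by apply/mapP; exists (a, b).
Qed.

(** One group element works for both points: its base part brings rows from [S]
    to the finitely many places that are seen by [V] or [U], so that the two
    translates agree there, and its fiber part moves them into [U]. *)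
Lemma linked_of_rows (S : set nat) x z : absorbing P S ->
  rows_dense x -> rows_dense z ->
  (forall k, S k.1 -> entry k x = entry k z) -> linked shift x z.
Proof.
move=> aS dx dz xz V U [oV V1] oU Une.
have {Une} [u Uu] : U !=set0 by case: Une => -[u [Uu _]]; exists u.
have [L [e e0 LU]] := coord_nbhs entry_cvg (open_nbhs_nbhs (conj oU Uu)).
have [M MV] := nbhs1_wreath (open_nbhs_nbhs (conj oV V1)).
pose F := [seq a <- [seq k.1 | k <- L ++ M] | `[< A a >]].
have [|p Pp pS] := aS F; first by move=> a; rewrite mem_filter => /andP[/asboolP].
have {}pS a : a \in [seq k.1 | k <- L ++ M] -> A a -> S (p a).
  by move=> aL Aa; apply: pS; rewrite mem_filter aL andbT; exact/asboolP.
have /choice[r Hr] a : exists r : Q, forall b, b \in [seq k.2 | k <- L] ->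
    infinite_part (a, b) -> `|entry (p a, val r b) x - entry (a, b) u| < e.
  have [Aa|nA] := pselect (A a); last by exists 1%g => b _ [].
  have [|q Qq Hq] :=
    dx (p a) _ (fun b => entry (a, b) u) [seq k.2 | k <- L] e e0.
    exact: infinite_orbit_act.
  by exists (SigSub (mem_set Qq)) => b bL [_ Bb]; exact: Hq.
(* The translating element is the inverse of [h], since the shift by it reads
   entry [k] at the place [wreath_fun h k]. *)
pose h : wreath P Q := (SigSub (mem_set Pp) : P, r : {ptws nat -> Q}).
have agree k : k.1 \in [seq k.1 | k <- L ++ M] ->
    entry k (shift h^-1%g x) = entry k (shift h^-1%g z).
  move=> kLM; rewrite !entry_shift_inv.
  have [[Aa _]|nk] := pselect (infinite_part k).
    by apply: xz; exact: pS.
  by rewrite !entry0 // => /infinite_part_act_inv.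
have Ux : U (shift h^-1%g x).
  apply: LU => k kL; rewrite entry_shift_inv distrC.
  have [Ik|nk] := pselect (infinite_part k).
    by case: k kL Ik => a b kL; apply: Hr; apply/mapP; exists (a, b).
  by rewrite !entry0 ?subrr ?normr0 // => /infinite_part_act_inv.
have Uz : U (shift h^-1%g z).
  apply: LU => k kL; rewrite -agree; last by rewrite map_cat mem_cat map_f.
  rewrite entry_shift_inv distrC.
  have [Ik|nk] := pselect (infinite_part k).
    by case: k kL Ik => a b kL; apply: Hr; apply/mapP; exists (a, b).
  by rewrite !entry0 ?subrr ?normr0 // => /infinite_part_act_inv.
have agreeM k : k.1 \in [seq k.1 | k <- M] ->
    entry k (shift h^-1%g x) = entry k (shift h^-1%g z).
  by move=> kM; apply: agree; rewrite map_cat mem_cat kM orbT.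
exists h^-1%g, h^-1%g; split=> //.
  by apply: (closure_translates MV) => //; exact: rows_dense_shift.
by apply: (closure_translates MV) => [|k /agreeM//]; exact: rows_dense_shift.
Qed.

Definition mix (S : set nat) (x y : Y) : Y :=
  mk_subshift (fun k => if `[< S k.1 >] then entry k x else entry k y).

Lemma entry_mix S x y k :
  entry k (mix S x y) = if `[< S k.1 >] then entry k x else entry k y.
Proof.
have [Ik|nk] := pselect (infinite_part k); first by rewrite entry_mk.
by rewrite !entry0 // if_same.
Qed.

Lemma mixl_continuous S y : continuous (mix S ^~ y).
Proof.
move=> x; have [_] := entry_cvg (mix S x y) (fmap_filter (mix S ^~ y) (nbhs_filter x)).
apply=> k; apply/cvgrPdist_lt => e e0.
apply: filterS (entry_near k x e0) => x' /= xx'; rewrite !entry_mix.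
by case: ifP => // _; rewrite subrr normr0.
Qed.

Lemma mixr_continuous S x : continuous (mix S x).
Proof.
move=> y; have [_] := entry_cvg (mix S x y) (fmap_filter (mix S x) (nbhs_filter y)).
apply=> k; apply/cvgrPdist_lt => e e0.
apply: filterS (entry_near k y e0) => y' /= yy'; rewrite !entry_mix.
by case: ifP => // _; rewrite subrr normr0.
Qed.

Lemma mixxx S x : mix S x x = x.
Proof. by apply: entry_inj => k; rewrite entry_mix if_same. Qed.

Lemma mix_mix S a b c d : mix S (mix S a b) (mix S c d) = mix S a d.
Proof. by apply: entry_inj => k; rewrite !entry_mix; case: `[< S k.1 >]. Qed.

(** Replacing the rows outside [S] by those of a generic [u] gives points that are
    linked to [x] and to [y] through [S], and to each other through the complement
    of [S]; genericity of [u] keeps them in [C]. *)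
Lemma subshift_semi_connected : generically_semi_connected shift.
Proof.
move=> C _ /comeager_dense_open[W [oW dW WC]].
have [S [S1 S2]] := absorbing_split P.
pose W' (j : nat + (nat * seq nat) * (seq rat * nat)) := match j with
  | inl n => W n
  | inr i => row_approx i
  end.
have oW' j : open (W' j) by case: j => // i; exact: row_approx_open.
have dW' j : dense (W' j) by case: j => // i; exact: row_approx_dense.
have [D [cD DW Dmix]] := generic_mix (mk_subshift (fun=> 0)) subshift_polish
  (coord_base_open entry_cvg) (coord_baseP entry_cvg)
  (@mixl_continuous S) (@mixr_continuous S) (mixxx S) (mix_mix S) oW' dW'.
have inC y : (forall j, W' j y) -> C y.
  by move=> Wy; apply: WC => n _; exact: (Wy (inl n)).
have dense_rows y : (forall j, W' j y) -> rows_dense y.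
  by move=> Wy a; apply: row_approxP => i; exact: (Wy (inr i)).
exists D; split=> // [x /DW Wx|x y Dx Dy]; first by apply: inC => j; exact: Wx.
have Wx j : W' j x by exact: (DW x Dx j).
have Wy j : W' j y by exact: (DW y Dy j).
have [u Hu] := Dmix x y Dx Dy.
have Wxu j : W' j (mix S x u) by have [] := Hu j.
have Wyu j : W' j (mix S y u) by have [] := Hu j.
(* The consecutive points agree on the rows in [S], in its complement, and in
   [S]. *)
exists 3%N, (nth x [:: x; mix S x u; mix S y u; y]); split=> //.
  by move=> [|[|[|[|]]]] // _; exact: inC.
move=> [|[|[|]]] //= _.
- apply: (linked_of_rows S1); [exact: dense_rows|exact: dense_rows|].
  by move=> k Sk; rewrite entry_mix asboolT.
- apply: (linked_of_rows S2); [exact: dense_rows|exact: dense_rows|].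
  by move=> k Sk; rewrite !entry_mix asboolF.
- apply: (linked_of_rows S1); [exact: dense_rows|exact: dense_rows|].
  by move=> k Sk; rewrite entry_mix asboolT.
Qed.

End subshift.

Unset Implicit Arguments.

Theorem corollary1p6 (R : realType) (P Q : polish_perm_group nat)
    (Pnc : ~ compact (ppg_set P)) (Qnc : ~ compact (ppg_set Q)) :
  exists (Y : set {ptws nat * nat -> R})
         (Yinv : invariant_set (@wreath_bernoulli R nat nat P Q) Y),
    [/\ closed Y, Y !=set0,
        polish_Gspace (restr_act Yinv) R &
        generically_unbalanced (restr_act Yinv)].
Proof.
have [a Aa] := noncompact_infinite_orbit Pnc.
have [b Bb] := noncompact_infinite_orbit Qnc.
exists (@subshift R P Q), (@subshift_invariant R P Q); split.
- exact: subshift_closed.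
- by exists (fun=> 0).
- exact: subshift_polish_Gspace.
- split; last exact: subshift_semi_connected.
  by move=> x; exact: (orbit_meager x Aa Bb).
Qed.
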